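(* Let $V$ be a locally linearly compact vector space over a discrete field $\mathbb K$ and let $\phi\colon V\to V$ be a continuous endomorphism. Then $\mathrm{ent}(\phi^k)=k\cdot\mathrm{ent}(\phi)$ for every $k\in\mathbb N$.
   Context: $\mathbb N$ includes $0$, $\phi^0=\mathrm{id}_V$, and $0\cdot\infty=0$. $\mathbb K$ is an arbitrary field endowed with the discrete topology. A topological vector space over $\mathbb K$ is linearly topologized if it is Hausdorff and has a neighborhood basis at $0$ consisting of linear subspaces. A linear variety of $V$ is a coset $v+W$ of a linear subspace $W$; it is closed (open) if $W$ is closed (open). A linearly topologized vector space is linearly compact if every collection of closed linear varieties with the finite intersection property has non-empty intersection. A linearly topologized vector space is locally linearly compact (l.l.c.) if it has an open linear subspace that is linearly compact; $\mathcal B(V)$ denotes the family of all linearly compact open linear subspaces of $V$. ''Endomorphism'' means linear endomorphism. For a continuous endomorphism $\phi$ of an l.l.c. space $V$, $U\in\mathcal B(V)$ and a positive integer $n$, let $T_n(\phi,U)=U+\phi U+\dots+\phi^{n-1}U$. Define $H(\phi,U)=\lim_{n\to\infty}\frac1n\dim\frac{T_n(\phi,U)}{U}$ (the limit exists) and $\mathrm{ent}(\phi)=\sup\{H(\phi,U)\mid U\in\mathcal B(V)\}\in\mathbb N\cup\{\infty\}$. *)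

(* Defs.v *)
From HB Require Import structures.
From mathcomp Require Import all_boot all_order all_algebra.
From mathcomp Require Import all_classical all_reals all_analysis.

Set Implicit Arguments.
Unset Strict Implicit.
Unset Printing Implicit Defensive.

Import Order.TTheory GRing.Theory Num.Theory.

Local Open Scope classical_set_scope.
Local Open Scope ring_scope.

(* Topological vector spaces over an arbitrary field carrying the discrete
   topology.  The scaling is part of the mixin, rather than inherited from
   GRing.Lmodule, because HB would otherwise force a join with NbhsLmodule,
   whose scalars form a numDomainType; the lmodType instance follows. *)
HB.mixin Record TopologicalZmodule_isTopVect (K : fieldType) V
    & TopologicalZmodule V := {
  tv_scale : K -> V -> V;
  tv_scaleA : forall a b v, tv_scale a (tv_scale b v) = tv_scale (a * b) v;
  tv_scale1 : left_id 1 tv_scale;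
  tv_scaleDr : right_distributive tv_scale +%R;
  tv_scaleDl : forall v, {morph tv_scale^~ v : a b / a + b};
  tv_scale_continuous :
    continuous (fun z : discrete_topology K * V => tv_scale z.1 z.2)
}.

#[short(type="topVectType")]
HB.structure Definition TopVect (K : fieldType) :=
  {V of TopologicalZmodule V & TopologicalZmodule_isTopVect K V}.

HB.instance Definition _ (K : fieldType) (V : topVectType K) :=
  GRing.Zmodule_isLmodule.Build K V
    (@tv_scaleA K V) (@tv_scale1 K V) (@tv_scaleDr K V) (@tv_scaleDl K V).

Section LinearTopology.
Variables (K : fieldType) (V : topVectType K).
Implicit Types (U W C A B : set V).

Definition linear_subspace W := GRing.submod_closed (mem W).

Definition linearly_topologized :=
  hausdorff_space V /\
  forall A, nbhs (0 : V) A ->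
    exists W, [/\ linear_subspace W, nbhs (0 : V) W & W `<=` A].

(* C is a linear variety of the space U that is closed for the topology
   induced by V on U. *)
Definition closed_linear_variety U C :=
  exists v W, [/\ U v, W `<=` U, linear_subspace W,
    closed (W : set (subspace U)) & C = [set v + w | w in W]].

(* Linear compactness of the subspace U for the topology induced by V. *)
Definition linearly_compact U :=
  forall F : set (set V),
    F `<=` closed_linear_variety U -> finI F id -> \bigcap_(C in F) C !=set0.

Definition lc_open_subspaces : set (set V) :=
  [set U | [/\ linear_subspace U, open U & linearly_compact U]].

Definition locally_linearly_compact :=
  linearly_topologized /\ lc_open_subspaces !=set0.

(* For subspaces A `<=` B, the classes of the v i form a basis of B / A. *)
Definition quotient_basis B A n (v : 'I_n -> V) :=
  [/\ forall i, B (v i),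
      forall c : 'I_n -> K, A (\sum_i c i *: v i) -> forall i, c i = 0
    & forall x, B x -> exists c : 'I_n -> K, A (x - \sum_i c i *: v i)].

(* The dimension of B / A, equal to +oo when B / A has no finite basis. *)
Definition quotient_dim (R : realType) B A : \bar R :=
  xget +oo%E
    [set (n%:R%:E : \bar R) | n in
      [set n : nat | exists v : 'I_n -> V, quotient_basis B A v]].

(* U + phi U + ... + phi^(n-1) U *)
Definition trajectory (phi : V -> V) n U : set V :=
  [set \sum_(i < n) iter i phi (u i) | u in
    [set u : 'I_n -> V | forall i, U (u i)]].

Definition relative_entropy (R : realType) (phi : V -> V) U : \bar R :=
  limn (fun n => ((n%:R^-1 : R)%:E * quotient_dim R (trajectory phi n U) U)%E).

Definition entropy (R : realType) (phi : V -> V) : \bar R :=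
  ereal_sup [set relative_entropy R phi U | U in lc_open_subspaces].

End LinearTopology.

Arguments linearly_topologized {K} V.
Arguments locally_linearly_compact {K} V.
Arguments relative_entropy {K V} R phi U.
Arguments entropy {K V} R phi.

(* Main.v *)
(**
The dimensions of [T_(n+1) / T_n], where [T_n] is the trajectory of [U], are
finite and nonincreasing in [n], because [phi] maps each of these quotients onto
the next one.  They are thus eventually constant, equal to some [d], and
[H (phi, U) = d].  Writing [T_n (phi)] for the trajectories of [U], one has
[T_n (phi^k) <= T_(nk) (phi)], whence [H (phi^k, U) <= k H (phi, U)].  If
[E = T_k (phi)], the trajectory of length [n] of [E] under [phi^k] is exactly
[T_(nk) (phi)], and [E / U] is finite dimensional, whence
[H (phi^k, E) = k H (phi, U)]; moreover [E], a finite extension of [U], is again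
linearly compact and open.
*)

Require Import Defs.
From mathcomp Require Import all_boot all_order all_algebra.
From mathcomp Require Import all_classical all_reals all_analysis.
From mathcomp Require Import finmap zify ring.

Set Implicit Arguments.
Unset Strict Implicit.
Unset Printing Implicit Defensive.

Import Order.TTheory GRing.Theory Num.Theory.
Import numFieldNormedType.Exports.

Local Open Scope classical_set_scope.
Local Open Scope ring_scope.

(** * Linear subspaces and dimensions of quotients *)

Section LinearSubspace.
Variables (K : fieldType) (V : topVectType K).
Implicit Types (U W A B C D : set V).

Lemma linear_subspaceP W :
  linear_subspace W <->
  W 0 /\ forall (a : K) u v, W u -> W v -> W (a *: u + v).
Proof.
have memE (x : V) : reflect (W x) (x \in mem W) by exact: asboolP.
split=> [[/memE W0 Wl]|[W0 Wl]].
  by split=> // a u v /memE Wu /memE Wv; apply/memE/Wl.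
by split=> [|a u v /memE Wu /memE Wv]; apply/memE => //; apply: Wl.
Qed.

Lemma subspace0 W : linear_subspace W -> W 0.
Proof. by case/linear_subspaceP. Qed.

Lemma subspaceD W u v : linear_subspace W -> W u -> W v -> W (u + v).
Proof.
by case/linear_subspaceP=> _ Wl Wu Wv; rewrite -(scale1r u); apply: Wl.
Qed.

Lemma subspaceZ W (a : K) u : linear_subspace W -> W u -> W (a *: u).
Proof.
by case/linear_subspaceP=> W0 Wl Wu; rewrite -(addr0 (a *: u)); apply: Wl.
Qed.

Lemma subspaceB W u v : linear_subspace W -> W u -> W v -> W (u - v).
Proof.
move=> sW Wu Wv; rewrite -scaleN1r.
by apply: subspaceD => //; apply: subspaceZ.
Qed.

Lemma subspace_sum W n (u : 'I_n -> V) :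
  linear_subspace W -> (forall i, W (u i)) -> W (\sum_i u i).
Proof.
move=> sW Wu; elim/big_ind : _ => // [|x y]; first exact: subspace0.
exact: subspaceD.
Qed.

Lemma subspace_lincomb W n (c : 'I_n -> K) (u : 'I_n -> V) :
  linear_subspace W -> (forall i, W (u i)) -> W (\sum_i c i *: u i).
Proof. by move=> sW Wu; apply: subspace_sum => // i; apply: subspaceZ. Qed.

Lemma subspaceI A B :
  linear_subspace A -> linear_subspace B -> linear_subspace (A `&` B).
Proof.
move=> /linear_subspaceP[A0 Al] /linear_subspaceP[B0 Bl].
apply/linear_subspaceP; split=> // a u v [Au Bu] [Av Bv].
by split; [apply: Al|apply: Bl].
Qed.

Lemma subspace_preimage (f : {linear V -> V}) A :
  linear_subspace A -> linear_subspace (f @^-1` A).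
Proof.
move=> /linear_subspaceP[A0 Al]; apply/linear_subspaceP; split.
  by rewrite /preimage /= linear0.
by move=> a u v Au Av; rewrite /preimage /= linearP; apply: Al.
Qed.

Definition spans_mod A m (w : 'I_m -> V) B :=
  forall x, B x -> exists c : 'I_m -> K, A (x - \sum_i c i *: w i).

Definition free_mod A n (v : 'I_n -> V) :=
  forall c : 'I_n -> K, A (\sum_i c i *: v i) -> forall i, c i = 0.

Definition has_qdim B A n := exists v : 'I_n -> V, quotient_basis B A v.

Lemma spans_mod_subset A A' B B' m (w : 'I_m -> V) :
  A `<=` A' -> B' `<=` B -> spans_mod A w B -> spans_mod A' w B'.
Proof. by move=> AA' BB' sp x /BB'/sp[c Ac]; exists c; apply: AA'. Qed.

Lemma linear_lincomb (f : {linear V -> V}) n (c : 'I_n -> K) (v : 'I_n -> V) :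
  f (\sum_i c i *: v i) = \sum_i c i *: f (v i).
Proof. by rewrite linear_sum; apply: eq_bigr => i _; rewrite linearZ. Qed.

Lemma spans_mod_image (f : {linear V -> V}) A B m (w : 'I_m -> V) :
  spans_mod (f @^-1` A) w B -> spans_mod A (f \o w) (f @` B).
Proof.
move=> sw _ [x /sw[c Ac] <-]; exists c.
by move: Ac; rewrite /preimage /= linearB (linear_lincomb f).
Qed.

(** Steinitz bound: modulo [A], the coordinates of [v] on [w] form an [n] by [m] matrix. If [m < n],
    a nonzero vector of its left kernel gives a nontrivial relation on [v] modulo [A]. *)
Lemma free_mod_leq A B n m (v : 'I_n -> V) (w : 'I_m -> V) :
  linear_subspace A -> (forall i, B (v i)) -> free_mod A v ->
  spans_mod A w B -> (n <= m)%N.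
Proof.
move=> sA Bv fv sw; rewrite leqNgt; apply/negP => ltmn.
have /choice[M AM] i : exists c : 'I_m -> K, A (v i - \sum_j c j *: w j).
  exact: sw.
pose N : 'M[K]_(n, m) := \matrix_(i, j) M i j.
have : kermx N != 0.
  rewrite kermx_eq0 /row_free; apply/negP => /eqP rN.
  by have := rank_leq_col N; rewrite rN leqNgt ltmn.
case/rowV0Pn => u /sub_kermxP uN0 /eqP u0; apply: u0.
apply/rowP => i; rewrite mxE; apply: (fv (u 0)).
suff -> : \sum_i u 0 i *: v i = \sum_i u 0 i *: (v i - \sum_j M i j *: w j).
  exact: subspace_lincomb.
under [RHS]eq_bigr do rewrite scalerBr.
rewrite sumrB -[LHS]subr0; congr (_ - _).
under eq_bigr do rewrite scaler_sumr.
rewrite exchange_big /= big1 // => j _.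
under eq_bigr do rewrite scalerA.
rewrite -scaler_suml.
move/rowP/(_ j): uN0; rewrite !mxE => E.
rewrite (_ : \sum_i _ = 0) ?scale0r // -[RHS]E.
by apply: eq_bigr => k _; rewrite mxE.
Qed.

Lemma has_qdim_uniq B A n m :
  linear_subspace A -> has_qdim B A n -> has_qdim B A m -> n = m.
Proof.
move=> sA [v [Bv fv sv]] [w [Bw fw sw]]; apply/eqP; rewrite eqn_leq.
by rewrite (free_mod_leq sA Bv fv sw) (free_mod_leq sA Bw fw sv).
Qed.

(** Free families of [B] modulo [A] have length at most [m], so one of maximal length exists. It
    spans, since otherwise a missed vector [x] could be put in front of it. *)
Lemma spans_mod_has_qdim A B m (w : 'I_m -> V) :
  linear_subspace A -> spans_mod A w B ->
  exists2 n, (n <= m)%N & has_qdim B A n.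
Proof.
move=> sA sw.
pose P n := `[< exists v : 'I_n -> V, (forall i, B (v i)) /\ free_mod A v >].
have P0 : exists n, P n.
  by exists 0%N; apply/asboolP; exists (fun=> 0); split=> [[]//|c _ []//].
have Pm n : P n -> (n <= m)%N.
  by move/asboolP => [v [Bv fv]]; exact: free_mod_leq Bv fv sw.
case: (ex_maxnP P0 Pm) => n /[dup] Pn /asboolP[v [Bv fv]] maxn.
exists n; [exact: Pm|exists v; split=> // x Bx].
apply: contrapT => Ax.
suff /maxn : P n.+1 by rewrite ltnn.
apply/asboolP; exists (fun i => oapp v x (unlift ord0 i)); split.
  by move=> i; case: unliftP => [j _|_] /=.
move=> c; rewrite big_ord_recl /= unlift_none /=.
under eq_bigr do rewrite liftK /=.
(* A nonzero coefficient of [x] could be inverted, and [x] would be a combination of [v] modulo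
   [A]. *)
move=> Ac; have c0 : c ord0 = 0.
  apply/eqP/negPn/negP => c0; apply: Ax.
  exists (fun j => - ((c ord0)^-1 * c (lift ord0 j))).
  have := subspaceZ (c ord0)^-1 sA Ac.
  rewrite scalerDr scalerA mulVf// scale1r scaler_sumr -sumrN.
  by under eq_bigr do rewrite scalerA; under [in X in _ -> X]eq_bigr do
    rewrite scaleNr opprK.
move: Ac; rewrite c0 scale0r add0r => /fv cl i.
by case: (unliftP ord0 i) => [j ->|->//]; exact: cl.
Qed.

Lemma has_qdim_refl A : linear_subspace A -> has_qdim A A 0.
Proof.
move=> sA; exists (fun=> 0); split=> [[]//|c _ []//|x Ax].
by exists (fun=> 0); rewrite big_ord0 subr0.
Qed.

Lemma has_qdimD A B C n m : linear_subspace A -> linear_subspace B ->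
  A `<=` B -> B `<=` C -> has_qdim B A n -> has_qdim C B m ->
  has_qdim C A (n + m).
Proof.
move=> sA sB AB BC [v [Bv fv sv]] [w [Cw fw sw]].
exists (fun i : 'I_(n + m) =>
  match fintype.split i with inl j => v j | inr j => w j end).
have sumE (c : 'I_(n + m) -> K) :
    \sum_i c i *: match fintype.split i with inl j => v j | inr j => w j end =
    \sum_j c (lshift m j) *: v j + \sum_j c (rshift n j) *: w j.
  rewrite big_split_ord /=; congr (_ + _); apply: eq_bigr => j _.
    by rewrite (unsplitK (inl j)).
  by rewrite (unsplitK (inr j)).
split.
- by move=> i; case: fintype.split => j; [apply: BC|].
- move=> c; rewrite sumE => Ac.
  have Bc : B (\sum_j c (lshift m j) *: v j) by exact: subspace_lincomb.
  have cr : forall j, c (rshift n j) = 0.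
    by apply: fw; have := subspaceB sB (AB _ Ac) Bc; rewrite addrAC subrr add0r.
  move: Ac; rewrite [X in _ + X]big1 ?addr0 => [/fv cl i|j _]; last first.
    by rewrite cr scale0r.
  by case: (splitP i) => j ij; [have -> : i = lshift m j by exact: val_inj
    |have -> : i = rshift n j by exact: val_inj].
- move=> x /sw[c' /sv[c Ac]].
  exists (fun i : 'I_(n + m) =>
    match fintype.split i with inl j => c j | inr j => c' j end).
  rewrite sumE (eq_bigr (fun j => c j *: v j)) => [|j _]; last first.
    by rewrite (unsplitK (inl j)).
  rewrite [X in _ - (_ + X)](eq_bigr (fun j => c' j *: w j)) => [|j _];
    last first.
    by rewrite (unsplitK (inr j)).
  by rewrite opprD addrA addrAC.
Qed.

Lemma has_qdim_leq A B B' n n' : linear_subspace A -> B' `<=` B ->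
  has_qdim B A n -> has_qdim B' A n' -> (n' <= n)%N.
Proof.
move=> sA BB' [v [_ _ sv]] [w [Bw fw _]].
by apply: (free_mod_leq sA _ fw sv) => i; exact: BB'.
Qed.

Lemma quotient_dimE (R : realType) A B n : linear_subspace A ->
  has_qdim B A n -> quotient_dim R B A = n%:R%:E.
Proof.
move=> sA Bn; apply: xget_unique; first by exists n.
by move=> _ [m Bm <-]; rewrite (has_qdim_uniq sA Bn Bm).
Qed.

End LinearSubspace.

(** * Trajectories and their growth *)

Section Trajectory.
Variables (K : fieldType) (V : topVectType K).
Implicit Types (U W A B C D : set V) (f g : {linear V -> V}).

(** [iter k f] is a bare function; [g] carries the linear structure needed to apply the lemmas on
    linear maps to it. *)
Lemma iter_linear f k : exists g : {linear V -> V}, g = iter k f :> (V -> V).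
Proof.
elim: k => [|k [g gE]]; first by exists idfun.
by exists (f \o g); apply/funext => x /=; rewrite gE.
Qed.

Lemma trajectoryD f U n m x : trajectory f (n + m) U x <->
  exists y z, [/\ trajectory f n U y, trajectory f m U z & x = y + iter n f z].
Proof.
have [g gE] := iter_linear f n; split=> [[u Uu <-]|].
  exists (\sum_(i < n) iter i f (u (lshift m i))).
  exists (\sum_(i < m) iter i f (u (rshift n i))).
  split; [by exists (fun i => u (lshift m i))|
          by exists (fun i => u (rshift n i))|].
  rewrite -gE linear_sum big_split_ord /=; congr (_ + _).
  by apply: eq_bigr => i _; rewrite gE -iterD.
move=> [_ [_ [[u Uu <-] [w Uw <-] ->]]].
exists (fun i => match fintype.split i with inl j => u j | inr j => w j end).
  by move=> i; case: fintype.split.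
rewrite -gE linear_sum big_split_ord /=; congr (_ + _); apply: eq_bigr => i _.
  by rewrite (unsplitK (inl i)).
by rewrite (unsplitK (inr i)) gE -iterD.
Qed.

Lemma trajectory0 f U : trajectory f 0 U = [set 0].
Proof.
apply/seteqP; split=> [_ [u _ <-]|_ ->]; first by rewrite big_ord0.
by exists (fun=> 0) => [[]//|]; rewrite big_ord0.
Qed.

Lemma trajectory1 f U : trajectory f 1 U = U.
Proof.
apply/seteqP; split=> [_ [u Uu <-]|x Ux]; first by rewrite big_ord1; exact: Uu.
by exists (fun=> x) => //; rewrite big_ord1.
Qed.

Lemma trajectoryS f U n x : trajectory f n.+1 U x <->
  exists y z, [/\ U y, trajectory f n U z & x = y + f z].
Proof. by rewrite -add1n trajectoryD trajectory1. Qed.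

Lemma subspace_trajectory f U n :
  linear_subspace U -> linear_subspace (trajectory f n U).
Proof.
move=> sU; apply/linear_subspaceP; split.
  exists (fun=> 0) => [i|]; first exact: subspace0.
  by rewrite big1 // => i _; have [g <-] := iter_linear f i; rewrite linear0.
move=> a _ _ [u Uu <-] [v Uv <-]; exists (fun i => a *: u i + v i).
  by move=> i; apply: subspaceD => //; apply: subspaceZ.
rewrite scaler_sumr -big_split; apply: eq_bigr => i _.
by have [g <-] := iter_linear f i; rewrite linearP.
Qed.

Lemma trajectory_subset f U W n :
  U `<=` W -> trajectory f n U `<=` trajectory f n W.
Proof. by move=> UW _ [u Uu <-]; exists u => // i; apply: UW. Qed.

Lemma trajectory_leq f U n m : linear_subspace U -> (n <= m)%N ->
  trajectory f n U `<=` trajectory f m U.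
Proof.
move=> sU nm x Tx; rewrite -(subnKC nm); apply/trajectoryD.
exists x, 0; split=> //; first exact: subspace0 (subspace_trajectory _ _ sU).
by have [g <-] := iter_linear f n; rewrite linear0 addr0.
Qed.

Lemma sub_trajectory f U n : linear_subspace U -> (0 < n)%N ->
  U `<=` trajectory f n U.
Proof.
by move=> sU n0; rewrite -{1}(trajectory1 f U); apply: trajectory_leq.
Qed.

Lemma trajectory_iter f g U k n : g = iter k f :> (V -> V) ->
  trajectory g n (trajectory f k U) = trajectory f (n * k) U.
Proof.
move=> gE; elim: n => [|n IH]; first by rewrite mul0n !trajectory0.
apply/seteqP; split=> x.
  by move/trajectoryS; rewrite IH gE mulSn; move/trajectoryD.
by rewrite mulSn => /trajectoryD; rewrite -gE -IH => /trajectoryS.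
Qed.

Lemma sub_trajectory_iter f g U k n : linear_subspace U -> (0 < k)%N ->
  g = iter k f :> (V -> V) -> trajectory g n U `<=` trajectory f (n * k) U.
Proof.
move=> sU k0 gE; rewrite -(trajectory_iter U n gE).
by apply: trajectory_subset; apply: sub_trajectory.
Qed.

Lemma iter_sub_trajectory f U k n x : linear_subspace U ->
  trajectory f n U x -> trajectory f (k + n) U (iter k f x).
Proof.
move=> sU Tx; apply/trajectoryD; exists 0, x.
by rewrite add0r; split=> //; exact: subspace0 (subspace_trajectory _ _ sU).
Qed.

Lemma trajectory_id U n :
  linear_subspace U -> trajectory idfun n.+1 U = U.
Proof.
move=> sU; apply/seteqP; split; last exact: (@sub_trajectory idfun).
elim: n => [|n IH] x; first by rewrite (trajectory1 idfun).
move=> /(trajectoryS idfun)[y [z [Uy Tz ->]]].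
by apply: subspaceD => //; exact: IH.
Qed.

(* [f] induces a surjection of [T n.+1 / T n] onto [T n.+2 / T n.+1], where
   [T n] is the trajectory. *)
Lemma spans_trajectoryS f U n m (w : 'I_m -> V) : linear_subspace U ->
  spans_mod (trajectory f n U) w (trajectory f n.+1 U) ->
  spans_mod (trajectory f n.+1 U) (f \o w) (trajectory f n.+2 U).
Proof.
move=> sU sw x /trajectoryS[y [z [Uy /sw[c Tc] ->]]]; exists c.
apply/trajectoryS; exists y, (z - \sum_i c i *: w i); split=> //.
by rewrite linearB (linear_lincomb f) addrA.
Qed.

Lemma nonincreasing_nat_stationary (u : nat -> nat) :
  (forall n, u n.+1 <= u n)%N -> exists N, forall n, u (N + n)%N = u N.
Proof.
move=> du.
have ex : exists d, `[< exists n, u n = d >].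
  by exists (u 0%N); apply/asboolP; exists 0%N.
case: (ex_minnP ex) => d /asboolP[N uN] dmin; exists N.
elim=> [|n IH]; first by rewrite addn0.
apply/eqP; rewrite addnS eqn_leq -{1}IH du uN dmin //.
by apply/asboolP; exists (N + n).+1.
Qed.

(** * Trajectories when [f U] is finite dimensional modulo [U] *)

Section FiniteGrowth.
Variables (f : {linear V -> V}) (U : set V) (m : nat) (w : 'I_m -> V).
Hypotheses (sU : linear_subspace U) (sw : spans_mod U w (f @` U)).

Let T n := trajectory f n U.

Let sT n : linear_subspace (T n).
Proof. exact: subspace_trajectory. Qed.

Let TS n : T n `<=` T n.+1.
Proof. exact: trajectory_leq. Qed.

Lemma has_qdim_trajectoryS_ex n :
  exists d, has_qdim (T n.+2) (T n.+1) d.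
Proof.
elim: n => [|n [d [v [_ _ sv]]]]; last first.
  have [d' _] := spans_mod_has_qdim (sT _) (spans_trajectoryS sU sv).
  by exists d'.
suff sp : spans_mod (T 1) w (T 2).
  by have [d _] := spans_mod_has_qdim (sT _) sp; exists d.
rewrite /T => x /trajectoryS[y [z [Uy]]]; rewrite trajectory1 => Uz ->.
have [|c Uc] := sw (x := f z); first by exists z.
by exists c; rewrite -addrA; apply: subspaceD.
Qed.

(** The dimensions [u n] of the successive quotients are nonincreasing, hence equal to a constant
    [d] from some rank on. Summing them makes the dimension of [T n] over [U] eventually affine in
    [n], with slope [d]. *)
Lemma trajectory_growth :
  exists d c N, forall n, has_qdim (T (N + n)%N) U (c + n * d).
Proof.
have [u uE] := choice has_qdim_trajectoryS_ex.
have du n : (u n.+1 <= u n)%N.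
  have [v [_ _ sv]] := uE n.
  have [d' d'u /(has_qdim_uniq (sT _) (uE n.+1)) ->//] :=
    spans_mod_has_qdim (sT _) (spans_trajectoryS sU sv).
have [N uN] := nonincreasing_nat_stationary du.
have qT n : has_qdim (T n.+1) U (\sum_(i < n) u i).
  elim: n => [|n IH].
    by rewrite big_ord0 /T trajectory1; exact: has_qdim_refl.
  rewrite big_ord_recr /=; apply: has_qdimD IH (uE n) => //.
  exact: sub_trajectory.
(* The rank is [N.+1] because [qT] counts [n] successive quotients up to [T n.+1], starting from
   [T 1 = U]. *)
exists (u N), (\sum_(i < N) u i)%N, N.+1 => n.
have := qT (N + n)%N; rewrite big_split_ord /=.
rewrite [X in has_qdim _ _ (_ + X)](eq_bigr (fun=> u N)) => [|i _].
  by rewrite sum_nat_const card_ord.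
by rewrite uN.
Qed.

(** [T n.+1] lies in [T (N + n.+1)], whose basis modulo [U] is given by [trajectory_growth]. *)
Lemma has_qdim_trajectory n : exists d, has_qdim (T n.+1) U d.
Proof.
have [d [c [N /(_ n.+1)[v [_ _ sv]]]]] := trajectory_growth.
have [|e _ qe] := @spans_mod_has_qdim _ _ U (T n.+1) _ v sU; last by exists e.
apply: spans_mod_subset sv => //; apply: trajectory_leq => //.
exact: leq_addl.
Qed.

End FiniteGrowth.

Lemma relative_entropyE (R : realType) f U d c N : linear_subspace U ->
  (forall n, has_qdim (trajectory f (N + n) U) U (c + n * d)) ->
  relative_entropy R f U = d%:R%:E.
Proof.
move=> sU qT; apply: cvg_lim => //.
(* After this shift the denominator [N + n.+1] is nonzero, and the quotient
   [(c + n.+1 * d) / (N + n.+1)] equals [d + (c - N * d) / (N + n.+1)]. *)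
rewrite -(cvg_shiftn N.+1).
have -> : [sequence ((n + N.+1)%:R^-1%:E *
    quotient_dim R (trajectory f (n + N.+1) U) U)%E]_n =
    EFin \o (fun n => d%:R + (c%:R - N%:R * d%:R) *
                       ((n + N.+1)%:R)^-1 :> R).
  apply/funext => n /=.
  have -> : (n + N.+1 = N + n.+1)%N by rewrite addnC addSnnS.
  rewrite (quotient_dimE R sU (qT _)) -EFinM; congr (_%:E).
  rewrite !natrD natrM.
  have : N%:R + n.+1%:R != 0 :> R by rewrite -natrD pnatr_eq0 addnS.
  by move=> ?; field.
apply: cvg_EFin; first exact: nearW.
rewrite -[X in _ --> X]addr0; apply: cvgD; first exact: cvg_cst.
rewrite -[X in _ --> X](mulr0 (c%:R - N%:R * d%:R)).
apply: cvgMl_tmp.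
under eq_fun do rewrite addnS.
exact: (cvg_comp _ _ (cvg_addnr N) (@cvg_harmonic R)).
Qed.

End Trajectory.

(** * Linear compactness: cofiniteness and finite extensions *)

Section LinearCompactness.
Variables (K : fieldType) (V : topVectType K).
Implicit Types (U W A B C D : set V) (F : set (set V)).

Lemma nbhs_translate A (x : V) : nbhs 0 A -> nbhs x [set y | A (y - x)].
Proof.
move=> A0; have : (fun y : V => y - x) @ x --> (0 : V).
  rewrite -[X in _ --> X](subrr x).
  apply: (@cvg_comp _ _ _ (fun y : V => (y, x)) (fun z => z.1 - z.2) _ _ _ _
    (@sub_continuous V (x, x))).
  by apply: cvg_pair; [exact: cvg_id|exact: cvg_cst].
by move/(_ A A0).
Qed.

Lemma subspace_open W : linear_subspace W -> nbhs 0 W -> open W.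
Proof.
move=> sW W0; rewrite openE => x Wx.
apply: filterS (nbhs_translate x W0) => y Wyx.
by rewrite -(subrK x y); apply: subspaceD.
Qed.

Lemma subspace_closed W : linear_subspace W -> nbhs 0 W -> closed W.
Proof.
move=> sW W0; rewrite -[W]setCK closedC openE => x Wx.
apply: filterS (nbhs_translate x W0) => y Wyx Wy; apply: Wx.
by rewrite -(subKr y x); apply: subspaceB.
Qed.

(** Sequences instead of finite sets: finite subfamilies are concatenated, mapped and treated by
    induction below. *)
Lemma finI_seqP F : finI F id <->
  forall s : seq (set V), (forall C, C \in s -> F C) ->
    exists y, forall C, C \in s -> C y.
Proof.
split=> [fF s sF|sF D' D'F].
  have [C|y Dy] := fF [fset C in s]%fset.
    by rewrite in_fset => /sF FC; apply/mem_set.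
  by exists y => C Cs; apply: Dy; rewrite /= in_fset.
have [C /D'F /set_mem//|y yP] := sF (enum_fset D').
by exists y => C; exact: yP.
Qed.

(* If [U / W] were infinite dimensional, it would contain an independent
   sequence [x], and a point of all the varieties
   [x 0 + ... + x n.-1 + span (x i : i >= n) + W] would have all its coordinates
   on [x] equal to 1.  The span of [x] is the image of the polynomials under
   [L]. *)
Lemma linearly_compact_cofinite U W :
  linear_subspace U -> open U -> linearly_compact U ->
  linear_subspace W -> open W -> exists m (w : 'I_m -> V), spans_mod W w U.
Proof.
move=> sU oU lcU sW oW; apply: contrapT => nofin.
have U0 : nbhs 0 U by apply: open_nbhs_nbhs; split=> //; exact: subspace0.
have W0 : nbhs 0 W by apply: open_nbhs_nbhs; split=> //; exact: subspace0.
(* [g s] is a vector of [U] outside [W] + span(s). Iterating the choice on the list of earlier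
   vectors yields the independent sequence [x]. *)
have /choice[g gP] (s : seq V) : exists x, U x /\
    forall c : nat -> K, ~ W (x - \sum_(i < size s) c i *: s`_i).
  apply: contrapT => no; apply: nofin.
  exists (size s), (fun i => s`_i) => x Ux; apply: contrapT => nc.
  apply: no; exists x; split=> // c Wc; apply: nc.
  by exists (fun i => c i).
pose sq n := iter n (fun s => rcons s (g s)) [::].
have [x xE] : exists x, forall n, x n = g (sq n) by exists (g \o sq).
have sqE n : sq n = mkseq x n.
  by elim: n => [|n IH] //; rewrite mkseqS -IH xE.
have xU n : U (x n) by rewrite xE; exact: (gP _).1.
have xW n (c : nat -> K) : ~ W (x n - \sum_(i < n) c i *: x i).
  have := (gP (sq n)).2 c; rewrite -xE sqE size_mkseq.
  by under eq_bigr do rewrite nth_mkseq//.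
pose L (p : {poly K}) := \sum_(i < size p) p`_i *: x i.
have Lwide n (p : {poly K}) : (size p <= n)%N -> L p = \sum_(i < n) p`_i *: x i.
  move=> pn; rewrite /L (big_ord_widen n (fun i => p`_i *: x i))// big_mkcond.
  apply: eq_bigr => i _; case: ltnP => // pi.
  by rewrite nth_default// scale0r.
have LP (a : K) (p q : {poly K}) : L (a *: p + q) = a *: L p + L q.
  pose n := maxn (size (a *: p + q)) (maxn (size p) (size q)).
  rewrite !(Lwide n) /n ?leq_max ?leqnn ?orbT//.
  rewrite scaler_sumr -big_split; apply: eq_bigr => i _.
  by rewrite coefD coefZ scalerDl scalerA.
have LB (p q : {poly K}) : L (p - q) = L p - L q.
  by rewrite addrC -scaleN1r LP scaleN1r addrC.
have L0 : L 0 = 0 by rewrite /L size_poly0 big_ord0.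
have LU (p : {poly K}) : U (L p) by exact: subspace_lincomb.
(* Dividing by the leading coefficient would express [x (size p).-1] modulo [W] by the earlier terms
   of [x]. *)
have Linj (p : {poly K}) : W (L p) -> p = 0.
  move=> Wp; apply/eqP/negPn/negP => p0.
  have sp : size p = (size p).-1.+1 by rewrite prednK // size_poly_gt0.
  apply: (@xW (size p).-1 (fun i => - (lead_coef p)^-1 * p`_i)).
  have := subspaceZ (lead_coef p)^-1 sW Wp.
  rewrite (Lwide (size p).-1.+1) -?sp // sp big_ord_recr /= scalerDr scalerA.
  rewrite mulVf ?lead_coef_eq0// scale1r addrC scaler_sumr -sumrN.
  by under eq_bigr do rewrite scalerA -[X in X *: _]opprK -mulNr scaleNr.
pose s n : {poly K} := \poly_(i < n) 1.
have sD m n : s (m + n)%N = s m + 'X^m * s n.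
  apply/polyP => i; rewrite coefD coefXnM !coef_poly.
  case: (ltnP i m) => im; first by rewrite addr0 (leq_trans im) ?leq_addr.
  by rewrite add0r ltn_subLR.
(* [E n] is the part in [U] of [W] + span(x i : i >= n), the multiples of ['X^n] giving that span.
   It contains the intersection of [U] and [W], hence is open, and so closed. [L (s n)] is
   [x 0 + ... + x n.-1]. *)
pose E n := [set y | U y /\ exists q, W (y - L ('X^n * q))].
pose C n := [set L (s n) + w | w in E n].
have sE n : linear_subspace (E n).
  apply/linear_subspaceP; split.
    split; first exact: subspace0.
    by exists 0; rewrite mulr0 L0 subr0; exact: subspace0.
  move=> a u v [Uu [p Wp]] [Uv [q Wq]]; split.
    by apply: subspaceD => //; apply: subspaceZ.
  exists (a *: p + q); rewrite mulrDr -scalerAr LP opprD addrACA -scalerBr.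
  by apply: subspaceD => //; apply: subspaceZ.
have [||y yC] := lcU (range C).
- move=> _ [n _ <-]; exists (L (s n)), (E n); split=> //; first by move=> z [].
  apply: closed_subspaceW; apply: subspace_closed => //.
  apply: filterS (filterI U0 W0) => z [Uz Wz]; split=> //.
  by exists 0; rewrite mulr0 L0 subr0.
- apply/finI_seqP => t tC.
  (* The point [L (s j)] lies in [C m] for every [j >= m]. Requiring membership for all [n] lets the
     induction on [t] add up the ranks. *)
  suff [N NP] : exists N, forall D, D \in t -> forall n, D (L (s (N + n)%N)).
    by exists (L (s N)) => D /NP/(_ 0%N); rewrite addn0.
  elim: t tC => [|D t IH] tC; first by exists 0%N.
  have [D' D't|N NP] := IH; first by apply: tC; rewrite inE D't orbT.
  have [m _ <-] := tC D (mem_head _ _); exists (m + N)%N => D'.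
  rewrite inE => /orP[/eqP ->|/NP DN] n; last first.
    by rewrite (addnC m) -addnA.
  exists (L (s (m + N + n)%N) - L (s m)); last by rewrite addrC subrK.
  split; first exact: subspaceB.
  exists (s (N + n)%N); rewrite -LB -addnA sD [_ - s m]addrAC subrr add0r subrr.
  exact: subspace0.
have [p Wp] : exists p, W (y - L p).
  have [w [_ [q Wq]] yE] : C 0%N y by apply: yC; exists 0%N.
  by exists q; rewrite -yE /s poly_def big_ord0 L0 add0r -[q]mul1r -(expr0 'X).
(* Modulo [W], [y] is both [L p] and [L] of a polynomial whose coefficient at [size p] is 1, while
   that of [p] is 0. Rank [(size p).+1] is the first that fixes this coefficient. *)
have [w [_ [q Wq]] yE] : C (size p).+1 y by apply: yC; exists (size p).+1.
have : W (L (s (size p).+1 + 'X^((size p).+1) * q - p)).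
  have -> : L (s (size p).+1 + 'X^((size p).+1) * q - p) =
            y - L p - (w - L ('X^((size p).+1) * q)).
    rewrite -yE LB -[s _]scale1r LP !scale1r !opprD opprK !addrA.
    by rewrite (addrAC _ w) addrK addrAC.
  exact: subspaceB.
move/Linj/polyP/(_ (size p)); rewrite coefB coefD coefXnM coef_poly ltnSn.
rewrite nth_default // addr0 subr0 coef0; exact/eqP/oner_neq0.
Qed.

(* The members of [F] have a common class modulo [U]: since [E / U] is at most a
   line, either every finite intersection of members of [F] meets [U], or some
   finite intersection lies in a single coset of [U]. *)
Lemma lc_open_subspaces_adjoin U (x : V) : lc_open_subspaces U ->
  lc_open_subspaces [set z | exists a : K, U (z - a *: x)].
Proof.
move=> [sU oU lcU]; set E := [set z | _].
have U0 : nbhs 0 U by apply: open_nbhs_nbhs; split=> //; exact: subspace0.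
have UE : U `<=` E by move=> z Uz; exists 0; rewrite scale0r subr0.
have sE : linear_subspace E.
  apply/linear_subspaceP; split; first by apply: UE; exact: subspace0.
  move=> a u v [b Ub] [c Uc]; exists (a * b + c).
  rewrite scalerDl -scalerA opprD addrACA -scalerBr.
  by apply: subspaceD => //; apply: subspaceZ.
split=> //; first by apply: subspace_open => //; exact: filterS U0.
move=> F FE fF.
have {}fF (t : seq (set V)) : (forall C, C \in t -> F C) ->
    exists2 y, E y & forall C, C \in t -> C y.
  case: t => [|C t] tF; first by exists 0; [exact: subspace0|].
  have [y yP] := (finI_seqP F).1 fF _ tF; exists y => //.
  have [v [W [Ev WE _ _ CE]]] := FE _ (tF _ (mem_head _ _)).
  by have := yP C (mem_head _ _); rewrite CE => -[w Ww <-];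
    apply: subspaceD => //; exact: WE.
(* Members of [F] contain the affine line through any two of their points. *)
have Faff C (y z : V) (t : K) : F C -> C y -> C z -> C (t *: (z - y) + y).
  move=> /FE[v [W [_ _ sW _ ->]]] [w Ww <-] [w' Ww' <-].
  exists (t *: (w' - w) + w).
    by apply: subspaceD => //; apply: subspaceZ => //; apply: subspaceB.
  by rewrite addrCA; congr (_ *: _ + _); rewrite opprD addrACA subrr add0r.
have [c cP] : exists c : K, forall t : seq (set V),
    (forall C, C \in t -> F C) ->
    exists2 y, U (y - c *: x) & forall C, C \in t -> C y.
  have [meetU|] := pselect (forall t : seq (set V),
      (forall C, C \in t -> F C) -> exists2 y, U y & forall C, C \in t -> C y).
    by exists 0 => t /meetU[y Uy yP]; exists y; rewrite // scale0r subr0.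
  move=> /existsNP[t0 /not_implyP[t0F nomeet]].
  have [y0 [c Uy0] y0P] := fF _ t0F; exists c => t tF.
  have [C|y [c' Uy] yP] := fF (t ++ t0).
    by rewrite mem_cat => /orP[/tF|/t0F].
  exists y => [|C Ct]; last by apply: yP; rewrite mem_cat Ct.
  have [<-//|c'c] := eqVneq c' c.
  exfalso; apply: nomeet.
  have cc0 : c' - c != 0 by rewrite subr_eq0.
  (* The classes of [y0] and [y] modulo [U] are those of [c *: x] and [c' *: x]; this parameter is
     where the line through [y0] and [y] enters [U], which contradicts [nomeet]. *)
  exists (- (c / (c' - c)) *: (y - y0) + y0) => [|C Ct0]; last first.
    by apply: Faff; [exact: t0F|exact: y0P|apply: yP; rewrite mem_cat Ct0 orbT].
  set t1 := - (c / (c' - c)).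
  have t1E : t1 * (c' - c) = - c by rewrite mulNr divfK.
  have -> : t1 *: (y - y0) + y0 =
      t1 *: ((y - c' *: x) - (y0 - c *: x)) + (y0 - c *: x).
    have -> : (y - c' *: x) - (y0 - c *: x) = (y - y0) - (c' - c) *: x.
      by rewrite opprD addrACA -opprD scalerBl.
    rewrite [in RHS]scalerBr scalerA t1E (scaleNr c) opprK -addrA.
    by congr (_ + _); rewrite addrCA subrr addr0.
  by apply: subspaceD => //; apply: subspaceZ => //; apply: subspaceB.
(* Translating by [- c *: x] brings the common coset into [U], where linear compactness applies. *)
pose G C := [set y | U y /\ C (y + c *: x)].
have [||y yP] := lcU (G @` F).
- move=> _ [C FC <-]; have [D|y Uy /(_ C (mem_head _ _)) Cy] := cP [:: C].
    by rewrite inE => /eqP ->.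
  have [v [W [_ WE sW cW CE]]] := FE _ FC.
  exists (y - c *: x), (W `&` U); split=> //.
  + exact: subspaceI.
  (* A closed set [D] that cuts out [W] in [E] also cuts out the trace of [W] in the smaller space
     [U]. *)
  + have /closed_subspaceP[D cD DE] := cW; apply/closed_subspaceP.
    exists D => //.
    rewrite -setIA setIid -(setIidr UE) !setIA DE.
    by rewrite -!setIA (setIidr UE).
  have [w Ww yE] : [set v + w | w in W] y by rewrite -CE.
  apply/seteqP; split=> u.
    rewrite /G CE => -[Uu [w' Ww' uE]].
    have E1 : w' - w = u - (y - c *: x).
      by rewrite opprB addrA -uE -yE opprD addrACA subrr add0r.
    exists (u - (y - c *: x)); last by rewrite addrC subrK.
    by split; [rewrite -E1|]; apply: subspaceB.
  move=> [w1 [Ww1 Uw1] <-]; split; first exact: subspaceD.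
  rewrite CE; exists (w + w1); first exact: subspaceD.
  by rewrite addrAC subrK addrA yE.
- apply/finI_seqP => t tG.
  have /choice[h hP] C : exists D, (G @` F) C -> F D /\ C = G D.
    have [[D FD <-]|nG] := pselect ((G @` F) C); first by exists D.
    by exists set0.
  have [_ /mapP[C /tG/hP[FC _] ->//]|y Uy yP] := cP (map h t).
  exists (y - c *: x) => C Ct; have [_ ->] := hP C (tG C Ct).
  by split=> //; rewrite subrK; apply: yP; exact: map_f.
exists (y + c *: x) => C FC.
by have [] : G C y by apply: yP; exists C.
Qed.

(** Induction on [n]: first adjoin [v ord0] to [U], then the remaining vectors. *)
Lemma lc_open_subspaces_span U n (v : 'I_n -> V) : lc_open_subspaces U ->
  lc_open_subspaces [set z | exists c : 'I_n -> K, U (z - \sum_i c i *: v i)].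
Proof.
elim: n v U => [|n IH] v U BU.
  rewrite (_ : [set z | _] = U)//; apply/seteqP; split=> z /=.
    by move=> [c]; rewrite big_ord0 subr0.
  by move=> Uz; exists (fun=> 0); rewrite big_ord0 subr0.
have := IH (fun i => v (lift ord0 i)) _ (lc_open_subspaces_adjoin (v ord0) BU).
congr lc_open_subspaces; apply/seteqP; split=> z /=.
  move=> [c [a Ua]]; exists (fun i => oapp c a (unlift ord0 i)).
  rewrite big_ord_recl unlift_none /= opprD addrA addrAC.
  by under eq_bigr do rewrite liftK.
move=> [c Uc]; exists (fun i => c (lift ord0 i)), (c ord0).
by move: Uc; rewrite big_ord_recl opprD addrA addrAC.
Qed.

Lemma lc_open_subspaces_finite_ext U E n : lc_open_subspaces U ->
  linear_subspace E -> U `<=` E -> has_qdim E U n -> lc_open_subspaces E.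
Proof.
move=> BU sE UE [v [Ev _ sv]].
rewrite (_ : E = [set z | exists c : 'I_n -> K, U (z - \sum_i c i *: v i)]).
  exact: lc_open_subspaces_span.
apply/seteqP; split=> [z /sv//|z [c Uc]].
rewrite -(subrK (\sum_i c i *: v i) z); apply: subspaceD => //; first exact: UE.
exact: subspace_lincomb.
Qed.

End LinearCompactness.

(** * Relative entropy of an iterate *)

Section RelativeEntropyIter.
Variables (R : realType) (K : fieldType) (V : topVectType K).
Variables (f g : {linear V -> V}) (k : nat) (U : set V).
Variables (m : nat) (w : 'I_m -> V).
Hypotheses (sU : linear_subspace U) (sw : spans_mod U w (f @` U)).
Hypotheses (k_gt0 : (0 < k)%N) (gE : g = iter k f :> (V -> V)).

(** [g] maps [T_(n+1)] into [T_(k+n+1)], which is finite dimensional modulo [U]. This is the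
    finiteness hypothesis that the growth results require for [g]. *)
Let iter_image_spans n : exists m (w : 'I_m -> V),
  spans_mod U w (g @` trajectory f n.+1 U).
Proof.
have [d [v [_ _ sv]]] := has_qdim_trajectory sU sw (k + n).
exists d, v; apply: spans_mod_subset sv => // _ [x Tx <-].
by rewrite gE -addnS; exact: iter_sub_trajectory.
Qed.

Lemma relative_entropy_iter_le :
  (relative_entropy R g U <= k%:R%:E * relative_entropy R f U)%E.
Proof.
have [d [c [N qT]]] := trajectory_growth sU sw.
have [m' [w' sw']] := iter_image_spans 0; rewrite trajectory1 in sw'.
have [d' [c' [N' qT']]] := trajectory_growth sU sw'.
rewrite (relative_entropyE R sU qT) (relative_entropyE R sU qT').
rewrite -EFinM lee_fin -natrM ler_nat leqNgt; apply/negP => kd.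
(* Large enough for the slope [d' > k * d] to outgrow all the constants, and at least [N], so that
   the subtraction below is not truncated. *)
pose n := (N + (c + (N' + N) * (k * d)).+1)%N.
have kn : ((N' + n) * k = N + ((N' + n) * k - N))%N.
  rewrite subnKC//; apply: leq_trans (leq_pmulr _ k_gt0).
  by rewrite addnCA leq_addr.
have : (c' + n * d' <= c + ((N' + n) * k - N) * d)%N.
  apply: has_qdim_leq (qT _) (qT' n) => //.
  by rewrite -kn; exact: sub_trajectory_iter.
move: kn kd; rewrite /n; clear; nia.
Qed.

Lemma relative_entropy_iter_trajectory :
  relative_entropy R g (trajectory f k U) =
  (k%:R%:E * relative_entropy R f U)%E.
Proof.
have [d [c [N qT]]] := trajectory_growth sU sw.
set E := trajectory f k U.
have sE : linear_subspace E by exact: subspace_trajectory.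
have UE : U `<=` E by exact: sub_trajectory.
have [e qE] : exists e, has_qdim E U e.
  by have := has_qdim_trajectory sU sw k.-1; rewrite prednK.
have [m' [w' sw']] : exists m (w : 'I_m -> V), spans_mod E w (g @` E).
  have [m' [w' sw']] := iter_image_spans k.-1; rewrite prednK // in sw'.
  by exists m', w'; exact: spans_mod_subset sw'.
have [d' [c' [N' qT']]] := trajectory_growth sE sw'.
rewrite (relative_entropyE R sU qT) (relative_entropyE R sE qT').
rewrite -EFinM -natrM; congr (_%:R%:E).
(* Both sides are the dimension of [T_((N' + n) * k)] over [U]: through [E] on the left, directly on
   the right. *)
have eq_dim n : (N < N' + n)%N ->
    (e + (c' + n * d') = c + ((N' + n) * k - N) * d)%N.
  move=> Nn.
  have kn : ((N' + n) * k = N + ((N' + n) * k - N))%N.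
    by rewrite subnKC// (leq_trans (ltnW Nn)) // leq_pmulr.
  apply: (has_qdim_uniq sU) (qT _); rewrite -kn -(trajectory_iter U _ gE).
  apply: has_qdimD qE (qT' n) => //.
  by apply: sub_trajectory => //; rewrite (leq_ltn_trans _ Nn).
(* Subtracting two consecutive instances leaves [d' = k * d]. *)
have := eq_dim N.+2; have := eq_dim N.+1.
have : (N <= N' + N)%N by rewrite leq_addl.
rewrite !addnS !ltnS => leN /(_ leN) + /(_ (leqW leN)).
move: k_gt0; clear; nia.
Qed.

End RelativeEntropyIter.

(** * Passage to the supremum *)

Theorem proposition4p4 (R : realType) (K : fieldType) (V : topVectType K)
    (phi : {linear V -> V}) (k : nat) :
  locally_linearly_compact V -> continuous phi ->
  entropy R (iter k phi) = (k%:R%:E * entropy R phi)%E.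
Proof.
move=> [_ [U0 BU0]] cphi.
(* By continuity the preimage of [U] under [phi] is an open subspace, so finitely many vectors span
   [U] modulo it; their images span [phi U] modulo [U]. *)
have fin_image U : lc_open_subspaces U ->
    exists m (w : 'I_m -> V), spans_mod U w (phi @` U).
  move=> [sU oU lcU].
  have [|m [w sw]] :=
    linearly_compact_cofinite sU oU lcU (subspace_preimage phi sU).
    by apply: open_comp => // x _; exact: cphi.
  by exists m, (phi \o w); exact: spans_mod_image.
have [g gE] := iter_linear phi k.
(* The factor [k] enters the supremum because the family is nonempty, as [U0] shows. *)
rewrite /entropy -ereal_supZl//; last first.
  by apply/set0P; exists (relative_entropy R phi U0), U0.
have [->|k_gt0] := posnP k.
  (* For [k = 0] every nonempty trajectory of the identity is [U], so all relative entropies vanish;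
     the other side vanishes by the convention that 0 times infinity is 0. *)
  have ent0 U : lc_open_subspaces U -> relative_entropy R (iter 0 phi) U = 0.
    move=> [sU _ _]; apply: (@relative_entropyE _ _ R idfun U 0 0 1 sU) => n.
    by rewrite muln0 trajectory_id //; exact: has_qdim_refl.
  congr ereal_sup; apply/seteqP; split=> [_ [U BU <-]|_ [_ [U BU <-] <-]].
    by exists (relative_entropy R phi U); [exists U|rewrite mul0e ent0].
  by exists U; rewrite // mul0e ent0.
apply/eqP; rewrite eq_le; apply/andP; split; apply: ge_ereal_sup => z.
  move=> [U BU <-]; have [sU _ _] := BU; have [m [w sw]] := fin_image U BU.
  rewrite -gE (le_trans (relative_entropy_iter_le R sU sw k_gt0 gE)) //.
  apply: ereal_sup_ubound; exists (relative_entropy R phi U) => //; by exists U.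
move=> [_ [U BU <-] <-]; have [sU _ _] := BU; have [m [w sw]] := fin_image U BU.
(* The value [k * H (phi, U)] is attained by [phi^k] at [T_k (phi)], a member of the family as a
   finite extension of [U]. *)
rewrite -(relative_entropy_iter_trajectory R sU sw k_gt0 gE) gE.
apply: ereal_sup_ubound; exists (trajectory phi k U) => //.
have [e qE] := has_qdim_trajectory sU sw k.-1; rewrite prednK // in qE.
apply: lc_open_subspaces_finite_ext BU _ _ qE.
  exact: subspace_trajectory.
exact: sub_trajectory.
Qed.
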